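(* Let $A$ be a C*-algebra such that there exists a $*$-homomorphism $B(H) \to A$ for some infinite-dimensional Hilbert space $H$. Then $A$ has no nontrivial AW*-discretization; that is, every AW*-discretization $\phi \colon A \to M$ has $M = 0$.
   Context: All algebras and subalgebras are unital and all homomorphisms preserve units (the zero algebra is allowed). $B(H)$ is the algebra of bounded operators on $H$. $\mathbf{AWstar}$ is the category of AW*-algebras with $*$-homomorphisms whose restriction to the projection lattices preserves arbitrary least upper bounds. $\mathrm{Spec}(C)$ is the Gelfand spectrum of a commutative C*-algebra $C$; $\ell^\infty(X)$ is the algebra of bounded complex functions on a set $X$. An AW*-discretization of a C*-algebra $A$ is a homomorphism $\phi \colon A \to M$ to an AW*-algebra $M$ whose restriction to each commutative C*-subalgebra $C$ of $A$ factors through the natural inclusion $C \simeq C(\mathrm{Spec}(C)) \to \ell^\infty(\mathrm{Spec}(C))$ via a morphism $\phi_C \colon \ell^\infty(\mathrm{Spec}(C)) \to M$ in $\mathbf{AWstar}$. *)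

(* Defs.v *)
From HB Require Import structures.
From mathcomp Require Import all_boot all_order all_algebra.
From mathcomp Require Import complex ring lra.
From mathcomp Require Import all_classical all_reals all_analysis.
Set Implicit Arguments.
Unset Strict Implicit.
Unset Printing Implicit Defensive.
Import Order.TTheory GRing.Theory Num.Theory Num.Def.
Import numFieldNormedType.Exports.
Local Open Scope classical_set_scope.
Local Open Scope ring_scope.

(* A unital complex *-algebra.  ssralg's algebra structures are nonzero rings,
   and the zero algebra has to be allowed here, so the product is a field of the
   mixin; the instances after each structure recover the ring operations. *)
HB.mixin Record isStarAlgebra (R : realType) (A : Type)
    & GRing.Lmodule R[i] A := {
  alg_one : A;
  alg_mul : A -> A -> A;
  alg_mulA : associative alg_mul;
  alg_mul1 : left_id alg_one alg_mul;
  alg_mulr1 : right_id alg_one alg_mul;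
  alg_mulDl : left_distributive alg_mul +%R;
  alg_mulDr : right_distributive alg_mul +%R;
  alg_mulZl : forall (k : R[i]) (x y : A),
    alg_mul (k *: x) y = k *: alg_mul x y;
  alg_mulZr : forall (k : R[i]) (x y : A),
    alg_mul x (k *: y) = k *: alg_mul x y;
  star : A -> A;
  starK : involutive star;
  starD : {morph star : x y / x + y};
  starZ : forall (k : R[i]) (x : A), star (k *: x) = k^* *: star x;
  star_alg_mul : forall x y : A, star (alg_mul x y) = alg_mul (star y) (star x)
}.

#[short(type="starAlgType")]
HB.structure Definition StarAlgebra (R : realType) :=
  {A of GRing.Lmodule R[i] A & isStarAlgebra R A}.

HB.instance Definition _ (R : realType) (A : starAlgType R) :=
  GRing.Zmodule_isPzRing.Build A (@alg_mulA R A) (@alg_mul1 R A)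
    (@alg_mulr1 R A) (@alg_mulDl R A) (@alg_mulDr R A).

Section StarAlgebraTheory.
Variables (R : realType) (A : starAlgType R).
Implicit Types x y : A.

Lemma starM x y : star (x * y) = star y * star x.
Proof. exact: star_alg_mul. Qed.

Lemma star_scaleAl (k : R[i]) x y : k *: (x * y) = (k *: x) * y.
Proof. by rewrite [RHS]alg_mulZl. Qed.

Lemma star_scaleAr (k : R[i]) x y : k *: (x * y) = x * (k *: y).
Proof. by rewrite [RHS]alg_mulZr. Qed.

Lemma star1 : star (1 : A) = 1.
Proof. by have := starM 1 (star 1); rewrite mul1r starK mul1r. Qed.

Lemma star0 : star (0 : A) = 0.
Proof. by apply: (addrI (star 0)); rewrite -starD !addr0. Qed.

Lemma starN x : star (- x) = - star x.
Proof. by apply/eqP; rewrite -addr_eq0 -starD addNr star0. Qed.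
End StarAlgebraTheory.

HB.mixin Record isStarPreserving (R : realType) (A B : starAlgType R)
    (f : A -> B) := {
  starhom1 : f 1 = 1;
  starhomM : {morph f : x y / x * y};
  starhom_star : {morph f : x / star x}
}.

HB.structure Definition StarMorphism (R : realType) (A B : starAlgType R) :=
  {f of @GRing.Linear R[i] A B *:%R f & isStarPreserving R A B f}.

Notation "{ 'starhom' A -> B }" := (@StarMorphism.type _ A%type B%type)
  (at level 0, A at level 98, B at level 99,
   format "{ 'starhom'  A  ->  B }") : type_scope.

HB.instance Definition _ (R : realType) (A B : starAlgType R)
    (f : {starhom A -> B}) :=
  GRing.isMonoidMorphism.Build A B f (@starhom1 R A B f, @starhomM R A B f).

HB.mixin Record isCStarAlgebra (R : realType) (A : Type)
    & CompleteNormedModule R[i] A & StarAlgebra R A := {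
  norm_alg_mul : forall x y : A, `|alg_mul x y| <= `|x| * `|y|;
  norm_star_mul : forall x : A, `|alg_mul (star x) x| = `|x| ^+ 2
}.

#[short(type="cstarAlgType")]
HB.structure Definition CStarAlgebra (R : realType) :=
  {A of CompleteNormedModule R[i] A & StarAlgebra R A & isCStarAlgebra R A}.

HB.instance Definition _ (R : realType) (A : cstarAlgType R) :=
  GRing.PzRing.copy A (A : starAlgType R).

Definition is_proj (R : realType) (A : starAlgType R) (p : A) : Prop :=
  p * p = p /\ star p = p.

(* An AW*-algebra is a C*-algebra that is a Baer *-ring: right annihilators of
   subsets are generated by a projection. *)
HB.mixin Record isAWStarAlgebra (R : realType) (A : Type)
    & CStarAlgebra R A := {
  right_ann_proj : forall S : set A, exists p : A, is_proj p /\
    [set x : A | forall s, S s -> alg_mul s x = 0]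
      = [set alg_mul p x | x in [set: A]]
}.

#[short(type="awstarAlgType")]
HB.structure Definition AWStarAlgebra (R : realType) :=
  {A of CStarAlgebra R A & isAWStarAlgebra R A}.

HB.instance Definition _ (R : realType) (A : awstarAlgType R) :=
  GRing.PzRing.copy A (A : starAlgType R).

HB.mixin Record isHilbert (R : realType) (H : Type)
    & CompleteNormedModule R[i] H := {
  inner : {dot H for (@Num.conj R[i])};
  norm_inner : forall x : H, `|x| ^+ 2 = inner x x
}.

#[short(type="hilbertType")]
HB.structure Definition Hilbert (R : realType) :=
  {H of CompleteNormedModule R[i] H & isHilbert R H}.

Section ComplexStar.
Variable R : realType.

HB.instance Definition _ := isStarAlgebra.Build R R[i]
  (@mulrA R[i]) (@mul1r R[i]) (@mulr1 R[i]) (@mulrDl R[i]) (@mulrDr R[i])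
  (fun k x y => esym (scalerAl k x y)) (fun k x y => mulrCA x k y)
  (@conjCK R[i]) (rmorphD (@Num.conj R[i])) (rmorphM (@Num.conj R[i]))
  (fun x y => etrans (rmorphM (@Num.conj R[i]) x y) (mulrC _ _)).
End ComplexStar.

Section FunStar.
Variables (R : realType) (X : Type).
Implicit Types f g h : X -> R[i].

Let fstar f : X -> R[i] := fun x => (f x)^*.
Let fmulZl (k : R[i]) f g : (k *: f) * g = k *: (f * g).
Proof. by apply/funext => x; exact/esym/(mulrA k (f x) (g x)). Qed.
Let fmulZr (k : R[i]) f g : f * (k *: g) = k *: (f * g).
Proof. by apply/funext => x; exact: (mulrCA (f x) k (g x)). Qed.
Let fstarK : involutive fstar.
Proof. by move=> f; apply/funext => x; exact: conjCK. Qed.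
Let fstarD : {morph fstar : f g / f + g}.
Proof. by move=> f g; apply/funext => x; exact: rmorphD. Qed.
Let fstarZ (k : R[i]) f : fstar (k *: f) = k^* *: fstar f.
Proof. by apply/funext => x; exact: rmorphM. Qed.
Let fstarM f g : fstar (f * g) = fstar g * fstar f.
Proof. by apply/funext => x; rewrite [RHS]mulrC; exact: rmorphM. Qed.

HB.instance Definition _ := isStarAlgebra.Build R (X -> R[i])
  (@mulrA (X -> R[i])) (@mul1r (X -> R[i])) (@mulr1 (X -> R[i]))
  (@mulrDl (X -> R[i])) (@mulrDr (X -> R[i]))
  fmulZl fmulZr fstarK fstarD fstarZ fstarM.
End FunStar.

(* A unital *-subalgebra, not required to be norm closed. *)
Record starSubalg (R : realType) (A : starAlgType R) := StarSubalg {
  subalg_set : set A;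
  subalg1 : subalg_set 1;
  subalgD : forall x y, subalg_set x -> subalg_set y -> subalg_set (x + y);
  subalgZ : forall (k : R[i]) x, subalg_set x -> subalg_set (k *: x);
  subalgM : forall x y, subalg_set x -> subalg_set y -> subalg_set (x * y);
  subalg_star : forall x, subalg_set x -> subalg_set (star x)
}.

Section SubalgType.
Variables (R : realType) (A : starAlgType R) (C : starSubalg A).

Definition subalg_pred : {pred A} := fun x => `[< subalg_set C x >].
Record subalg_type := SubalgElt {
  subalg_val :> A;
  subalg_valP : subalg_val \in subalg_pred
}.
HB.instance Definition _ := [isSub for subalg_val].
HB.instance Definition _ := [Choice of subalg_type by <:].

Let subalg_closed : GRing.subsemimod_closed subalg_pred.
Proof.
split; last by move=> k x /asboolP Cx; apply/asboolP/subalgZ.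
split; last by move=> x y /asboolP Cx /asboolP Cy; apply/asboolP/subalgD.
by apply/asboolP; have := subalgZ 0 (subalg1 C); rewrite scale0r.
Qed.
HB.instance Definition _ := GRing.isSubmodClosed.Build R[i] A subalg_pred subalg_closed.
HB.instance Definition _ := [SubChoice_isSubLmodule of subalg_type by <:].

Lemma subalgP (x : subalg_type) : subalg_set C (subalg_val x).
Proof. exact/asboolP/subalg_valP. Qed.

Definition subalg_elt (x : A) (Cx : subalg_set C x) : subalg_type := SubalgElt (asboolT Cx).
Let one := subalg_elt (subalg1 C).
Let mul (x y : subalg_type) := subalg_elt (subalgM (subalgP x) (subalgP y)).
Let st (x : subalg_type) := subalg_elt (subalg_star (subalgP x)).

Let mulA : associative mul.
Proof. by move=> x y z; apply/val_inj; rewrite /= mulrA. Qed.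
Let mul1 : left_id one mul.
Proof. by move=> x; apply/val_inj; rewrite /= mul1r. Qed.
Let mulr1 : right_id one mul.
Proof. by move=> x; apply/val_inj; rewrite /= mulr1. Qed.
Let mulDl : left_distributive mul +%R.
Proof. by move=> x y z; apply/val_inj; rewrite /= mulrDl. Qed.
Let mulDr : right_distributive mul +%R.
Proof. by move=> x y z; apply/val_inj; rewrite /= mulrDr. Qed.
Let mulZl (k : R[i]) x y : mul (k *: x) y = k *: mul x y.
Proof. by apply/val_inj; rewrite /= star_scaleAl. Qed.
Let mulZr (k : R[i]) x y : mul x (k *: y) = k *: mul x y.
Proof. by apply/val_inj; rewrite /= star_scaleAr. Qed.
Let stK : involutive st.
Proof. by move=> x; apply/val_inj; rewrite /= starK. Qed.
Let stD : {morph st : x y / x + y}.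
Proof. by move=> x y; apply/val_inj; rewrite /= starD. Qed.
Let stZ (k : R[i]) x : st (k *: x) = k^* *: st x.
Proof. by apply/val_inj; rewrite /= starZ. Qed.
Let stM x y : st (mul x y) = mul (st y) (st x).
Proof. by apply/val_inj; rewrite /= starM. Qed.

HB.instance Definition _ := isStarAlgebra.Build R subalg_type
  mulA mul1 mulr1 mulDl mulDr mulZl mulZr stK stD stZ stM.
HB.instance Definition _ :=
  GRing.PzRing.copy subalg_type (subalg_type : starAlgType R).
End SubalgType.

Section Linfty.
Variables (R : realType) (X : Type).

Definition bounded_funs : set (X -> R[i]) :=
  [set f | exists M : R[i], forall x, `|f x| <= M].

Let bounded1 : bounded_funs 1.
Proof. by exists 1 => x; rewrite normr1. Qed.
Let boundedD f g : bounded_funs f -> bounded_funs g -> bounded_funs (f + g).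
Proof.
move=> [M fM] [N gN]; exists (M + N) => x.
by rewrite (le_trans (ler_normD _ _))// lerD.
Qed.
Let boundedZ (k : R[i]) f : bounded_funs f -> bounded_funs (k *: f).
Proof. by move=> [M fM]; exists (`|k| * M) => x; rewrite normrM ler_wpM2l. Qed.
Let boundedM f g : bounded_funs f -> bounded_funs g -> bounded_funs (f * g).
Proof.
by move=> [M fM] [N gN]; exists (M * N) => x; rewrite normrM ler_pM.
Qed.
Let bounded_star f : bounded_funs f -> bounded_funs (star f).
Proof. by move=> [M fM]; exists M => x; rewrite norm_conjC. Qed.

Definition bounded_subalg : starSubalg (X -> R[i]) :=
  StarSubalg bounded1 boundedD boundedZ boundedM bounded_star.
Definition linfty : Type := subalg_type bounded_subalg.
HB.instance Definition _ := StarAlgebra.on linfty.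
HB.instance Definition _ := GRing.PzRing.copy linfty (linfty : starAlgType R).
End Linfty.

Section Characters.
Variables (R : realType) (A : cstarAlgType R).

Lemma complex_geo_small (r e : R[i]) : 0 <= r -> r < 1 -> 0 < e ->
  exists n, r ^+ n < e.
Proof.
case: r => r r'; case: e => e e'; rewrite !lecE/= => /andP[/eqP-> r0].
rewrite !ltcE/= => /andP[_ r1] /andP[/eqP-> e0].
have /cvgrPdist_lt /(_ e e0) [n _ /(_ n (leqnn n))] : 
   (fun n => r ^+ n) @ \oo --> (0 : R) by apply: cvg_expr; rewrite ger0_norm.
rewrite sub0r normrN ger0_norm ?exprn_ge0// => rn; exists n.
rewrite -[Complex r 0]/(real_complex R r) -rmorphXn/= ltcE/=.
by rewrite eqxx.
Qed.

(* Neumann series: b = z + z^2 + ... *)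
Lemma neumann (C : starSubalg A) (z : subalg_type C) :
  closed (subalg_set C) -> `|subalg_val z| < 1 ->
  exists b : subalg_type C, b = z + z * b.
Proof.
move=> Ccl; set w := subalg_val z; set r := `|w| => r1.
have r0 : 0 <= r by exact: normr_ge0.
have r1_gt0 : 0 < 1 - r by rewrite subr_gt0.
pose S := fix S n := if n is m.+1 then z + z * S m else 0.
pose s n : A := subalg_val (S n).
have sS n : s n.+1 = w + w * s n by [].
have ds n : `|s n.+1 - s n| <= r ^+ n.+1.
  elim: n => [|n IH].
    by rewrite sS /s/= mulr0 addr0 subr0 expr1.
  rewrite [in X in X - _]sS [in X in _ - X]sS opprD addrACA subrr add0r -mulrBr.
  by rewrite (le_trans (norm_alg_mul _ _))// exprS ler_wpM2l.
have dist_s n k : `|s (n + k)%N - s n| * (1 - r) <= r ^+ n.+1.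
  elim: k n => [|k IH] n; first by rewrite addn0 subrr normr0 mul0r exprn_ge0.
  rewrite -(subrKA (s n.+1)) addnS -addSn.
  rewrite (le_trans (ler_wpM2r (ltW r1_gt0) (ler_normD _ _)))// mulrDl.
  rewrite (le_trans (lerD (IH n.+1) (ler_wpM2r (ltW r1_gt0) (ds n))))//.
  by rewrite mulrBr mulr1 -exprSr addrC subrK.
have scvg : cvg (s @ \oo).
  apply/cauchy_cvgP/cauchy_exP => e e0.
  have [n rn] := complex_geo_small r0 r1 (mulr_gt0 e0 r1_gt0).
  exists (s n); exists n => // m /= nm.
  rewrite -ball_normE/= distrC -(subnKC nm) -(ltr_pM2r r1_gt0).
  rewrite (le_lt_trans (dist_s _ _))// (le_lt_trans _ rn)// exprS ler_piMl ?exprn_ge0//.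
  exact: ltW.
have Cb : subalg_set C (lim (s @ \oo)).
  apply: (closed_cvg _ Ccl _ _ scvg).
  by apply: nearW => n; exact: subalgP.
exists (subalg_elt Cb); apply/val_inj.
change (lim (s @ \oo) = w + w * lim (s @ \oo)).
set b := lim _; apply/eqP; rewrite -subr_eq0 -normr_le0.
apply: contraT; rewrite -real_ltNge ?normr_real// => d0.
have e0 := divr_gt0 d0 (ltr0Sn R[i] 1).
have /cvgrPdist_lt /(_ _ e0) [n _ sb] := scvg.
have E : b - (w + w * b) = (b - s n.+1) + w * (s n - b).
  by rewrite mulrBr sS !opprD !addrA subrK.
rewrite -(ltxx `|b - (w + w * b)|) {1}E.
rewrite (le_lt_trans (ler_normD _ _))// [ltRHS](splitr _).
rewrite ltrD ?sb//=.
rewrite (le_lt_trans (norm_alg_mul _ _))// (le_lt_trans _ (sb n (leqnn n)))//.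
by rewrite distrC ler_piMl// ltW.
Qed.

Lemma character_le (C : starSubalg A) (chi : {starhom (subalg_type C) -> R[i]})
    (c : subalg_type C) :
  closed (subalg_set C) -> `|chi c| <= `|subalg_val c|.
Proof.
move=> Ccl; rewrite real_leNgt ?normr_real//; apply/negP => lt_c.
have chi0 : chi c != 0.
  by apply: contraTneq lt_c => ->; rewrite normr0 real_ltNge ?normr_real ?normr_ge0.
pose z := (chi c)^-1 *: c.
have chiz : chi z = 1 by rewrite linearZ/= /GRing.scale/= mulVf.
have [|b bE] := @neumann C z Ccl.
  rewrite [subalg_val z]/(_ *: subalg_val c) normrZ normfV.
  by rewrite ltr_pdivrMl ?normr_gt0// mulr1.
have := congr1 chi bE; rewrite rmorphD rmorphM/= chiz mul1r.
by move=> /eqP; rewrite -subr_eq0 opprD addrCA subrr addr0 oppr_eq0 oner_eq0.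
Qed.
End Characters.

Section Riesz.
Variables (R : realType) (H : hilbertType R).
Implicit Types x y z v : H.
Local Notation "'[ x , y ]" := (@inner R H x y).
Local Notation re := (@complex.Re R).

Lemma innerC x y : '[y, x] = ('[x, y])^*.
Proof. by rewrite [LHS]hermC/= expr0 mul1r. Qed.

Lemma CauchySchwarz_inner x y : `|'[x, y]| <= `|x| * `|y|.
Proof.
have [->|y0] := eqVneq y 0; first by rewrite linear0r !normr0 mulr0.
have yy0 : 0 < '[y, y] by rewrite -norm_inner exprn_gt0// normr_gt0.
rewrite -(@ler_pXn2r _ 2)// ?nnegrE ?mulr_ge0// exprMn !norm_inner.
rewrite -subr_ge0 -(pmulr_rge0 _ yy0).
have : 0 <= `|'[y, y] *: x - '[x, y] *: y| ^+ 2 by rewrite exprn_ge0.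
rewrite norm_inner.
have -> : '['[y, y] *: x - '[x, y] *: y, '[y, y] *: x - '[x, y] *: y] =
    '[y, y] * ('[x, x] * '[y, y] - '[x, y] * '[y, x]).
  rewrite linearBl !linearBr/= !linearZl !linearZr/= -!innerC.
  rewrite -![_ *: (_ : R[i])]/(_ * _); ring.
by rewrite normCK -innerC.
Qed.

Let reD a b : re (a + b) = re a + re b. Proof. by case: a b => [? ?] [? ?]. Qed.
Let reN a : re (- a) = - re a. Proof. by case: a. Qed.
Let reJ a : re (a^*) = re a. Proof. by case: a. Qed.
Let reZ (k : R) a : re (k%:C%C * a) = k * re a.
Proof. by case: a => a b /=; rewrite mul0r subr0. Qed.

Lemma complex_norm_real (V : normedZmodType R[i]) (x : V) : exists2 r : R,
  0 <= r & `|x| = r%:C%C.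
Proof.
have /complex_realP[r xE] := normr_real x.
by exists r => //; rewrite -ler0c -xE.
Qed.

Lemma re_le_norm (c : R[i]) (r : R) : `|c| <= r%:C%C -> re c <= r.
Proof.
move=> cr; have := le_trans (normc_ge_Re c) cr; rewrite lecR.
exact/le_trans/ler_norm.
Qed.

Lemma Riesz (phi : H -> R[i]) (M : R[i]) : scalar phi ->
  (forall x, `|phi x| <= M * `|x|) -> exists z, forall x, phi x = '[x, z].
Proof.
move=> phil phiM.
have phi0 : phi 0 = 0.
  by apply/eqP; rewrite -normr_le0; have := phiM 0; rewrite normr0 mulr0.
have phiD x y : phi (x + y) = phi x + phi y.
  by rewrite -[x in LHS]scale1r phil mul1r.
have phiZ k x : phi (k *: x) = k * phi x by rewrite -[k *: x]addr0 phil phi0 addr0.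
have [m m0 phim] : exists2 m : R, 0 <= m & forall x, `|phi x| <= m%:C%C * `|x|.
  have [m m0 mE] := complex_norm_real (M : R[i]).
  exists m => // x; rewrite -mE -[leRHS]ger0_norm ?mulr_ge0//.
  by rewrite normrM normr_id -normrM ger0_norm// (le_trans _ (phiM x)).
pose J x := re '[x, x] - 2 * re (phi x).
have JD x v : J (x + v) = J x + re '[v, v] + 2 * re ('[v, x] - phi v).
  rewrite /J phiD linearDl !linearDr/= (innerC v x) !reD reJ reN; ring.
have J_ge x : - m ^+ 2 <= J x.
  have [r r0 xE] := complex_norm_real x.
  have -> : J x = r ^+ 2 - 2 * re (phi x).
    by rewrite /J -norm_inner xE -rmorphXn.
  have : re (phi x) <= m * r by apply: re_le_norm; have := phim x; rewrite xE -rmorphM.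
  by have := sqr_ge0 (r - m); rewrite sqrrB; lra.
have Jinf : has_inf (range J).
  by split; [exists (J 0), 0|exists (- m ^+ 2) => _ [x _ <-]].
pose mu := inf (range J).
have mu_le x : mu <= J x by apply: ge_inf; [case: Jinf|exists x].
have /choice[u uJ] : forall n : nat, exists x, J x < mu + n.+1%:R^-1.
  move=> n; have [|_ [x _ <-] Jx] := @inf_adherent _ (range J) n.+1%:R^-1 _ Jinf.
    by rewrite invr_gt0.
  by exists x.
have qZ (k : R) w : re '[k%:C%C *: w, k%:C%C *: w] = k ^+ 2 * re '[w, w].
  rewrite linearZl linearZr/=.
  have -> : (k%:C%C)^* = k%:C%C :> R[i] by exact: conjc_real.
  by rewrite !reZ mulrA expr2.
have LZ (k : R) x w : re ('[k%:C%C *: w, x] - phi (k%:C%C *: w))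
    = k * re ('[w, x] - phi w).
  by rewrite linearZl phiZ/= -mulrBr reZ.
have par x w : re '[w, w] <= 2 * (J x - mu) + 2 * (J (x + w) - mu).
  have := mu_le (x + (2^-1)%:C%C *: w).
  by rewrite !JD qZ LZ; lra.
have ucvg : cvg (u @ \oo).
  apply/cauchy_cvgP/cauchy_exP => e e0.
  have [r er] : exists r : R, e = r%:C%C.
    by apply/complex_realP; rewrite gtr0_real.
  have r0 : 0 < r by rewrite -ltcR -er.
  have [n _ nr] := near_infty_natSinv_lt (PosNum (divr_gt0 (exprn_gt0 2 r0) (ltr0Sn R 4))).
  exists (u n); exists n => // k /= nk.
  rewrite -ball_normE/=.
  have [d d0 dE] := complex_norm_real (u k - u n).
  rewrite distrC dE er ltcR -(ltr_pXn2r (ltn0Sn 1)) ?nnegrE ?(ltW r0)//.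
  have -> : d ^+ 2 = re '[u k - u n, u k - u n] by rewrite -norm_inner dE -rmorphXn.
  have := par (u n) (u k - u n); rewrite addrCA subrr addr0; have := uJ n; have := uJ k.
  have := nr n (leqnn n); have := nr k nk => /=.
  have := exprn_gt0 2 r0.
  move: (J (u k)) (J (u n)) (complex.Re _) (r ^+ 2) k.+1%:R^-1 n.+1%:R^-1 => a b c r2 k' n'.
  clear -R; move: mu => mu; lra.
pose z := lim (u @ \oo); exists z => v.
have inner_lim w e : 0 < e -> \forall n \near \oo, `|re '[w, u n] - re '[w, z]| < e.
  move=> e0; have [r r0 wE] := complex_norm_real w.
  have r1 : 0 < r + 1 by rewrite ltr_wpDl.
  have eC : 0 < (e / (r + 1))%:C%C :> R[i] by rewrite ltcR divr_gt0.
  have /cvgrPdist_lt /(_ _ eC) := ucvg.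
  apply: filterS => n; have [d d0 dE] := complex_norm_real (z - u n).
  rewrite dE ltcR ltr_pdivlMr// => de.
  have := CauchySchwarz_inner w (z - u n); rewrite wE dE -rmorphM linearBr/=.
  rewrite distrC -reN -reD => wz.
  have := le_trans (normc_ge_Re _) wz; rewrite lecR => /le_lt_trans; apply.
  nra.
have main w : 0 <= re '[w, w] + 2 * re ('[w, z] - phi w).
  rewrite leNgt; apply/negP => lt0.
  have [E EE] : exists E, E = re '[w, w] + 2 * re ('[w, z] - phi w) by eexists.
  rewrite -EE in lt0; rewrite reD reN in EE.
  have e0 : 0 < - E / 4 by lra.
  near \oo => n.
  have : n.+1%:R^-1 < - E / 4 by near: n; exact: (near_infty_natSinv_lt (PosNum e0)).
  have : `|re '[w, u n] - re '[w, z]| < - E / 4 by near: n; exact: inner_lim.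
  rewrite ltr_norml => /andP[_].
  have := uJ n; have := mu_le (u n + w); rewrite JD reD reN.
  move: EE lt0; clear; move: mu (J _) n.+1%:R^-1 => mu j n'.
  lra.
apply/eqP; rewrite -subr_eq0; apply: contraT => nz.
set c := '[v, z] - phi v.
have c2 : 0 < re (c * c^*).
  have : 0 < `|c| ^+ 2 by rewrite exprn_gt0// normr_gt0 -oppr_eq0 opprB.
  by rewrite normCK ltcE => /andP[].
set t := (re '[v, v] + 1)^-1.
have q0 : 0 <= re '[v, v].
  by have [r r0 vE] := complex_norm_real v; rewrite -norm_inner vE -rmorphXn/= sqr_ge0.
have t0 : 0 < t by rewrite invr_gt0; lra.
have [P PE] : exists P : R, c * c^* = P%:C%C.
  by apply/complex_realP; rewrite -normCK rpredX// normr_real.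
have P0 : 0 < P by move: c2; rewrite PE.
have tq : t * re '[v, v] < 1 by rewrite mulrC ltr_pdivrMr; lra.
have := main ((- (t%:C%C * c^*)) *: v).
have -> : '[(- (t%:C%C * c^*)) *: v, z] - phi ((- (t%:C%C * c^*)) *: v)
    = - (t%:C%C * P%:C%C).
  by rewrite phiZ linearZl/= -mulrBr -/c -PE; ring.
have -> : '[(- (t%:C%C * c^*)) *: v, (- (t%:C%C * c^*)) *: v]
    = t%:C%C * (t%:C%C * (P%:C%C * '[v, v])).
  have tJ : (- (t%:C%C * c^*))^* = - (t%:C%C * c) :> R[i].
    rewrite rmorphN rmorphM/= conjCK; congr (- (_ * _)).
    exact: conjc_real.
  by rewrite linearZl linearZr/= tJ -PE; ring.
rewrite reN !reZ/= => h; exfalso; move: h tq t0 P0 q0.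
clear; move: (re _) t P => q t P h tq t0 P0 q0.
have tq2 : 0 < 2 - t * q by lra.
by have := mulr_gt0 (mulr_gt0 t0 P0) tq2; lra.
Unshelve. all: by end_near.
Qed.
End Riesz.

Section BoundedOperators.
Variables (R : realType) (H : hilbertType R).
Local Notation "'[ x , y ]" := (@inner R H x y).

Definition bounded_op : {pred H -> H} := fun T : H -> H =>
  `[< linear T /\ exists M : R[i], forall x, `|T x| <= M * `|x| >].

Record bounded_operator := BoundedOperator {
  bop_fun :> H -> H;
  bop_funP : bop_fun \in bounded_op
}.
HB.instance Definition _ := [isSub for bop_fun].
HB.instance Definition _ := [Choice of bounded_operator by <:].

Implicit Types T S U : bounded_operator.

Lemma bop_linear T : linear T.
Proof. by have /asboolP[] := bop_funP T. Qed.

Lemma bop_bounded T :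
  exists2 M : R[i], 0 <= M & forall x, `|T x| <= M * `|x|.
Proof.
have /asboolP[_ [M TM]] := bop_funP T; exists `|M| => // x.
rewrite -[leRHS]ger0_norm ?mulr_ge0// normrM normr_id -normrM.
by rewrite ger0_norm// (le_trans _ (TM x)).
Qed.

Let bounded_op_closed : GRing.subsemimod_closed bounded_op.
Proof.
split; [split|].
- apply/asboolP; split; first by move=> k x y; rewrite /= scaler0 addr0.
  by exists 0 => x; rewrite mul0r normr0.
- move=> T S /asboolP[Tl [M TM]] /asboolP[Sl [N SN]]; apply/asboolP; split.
    by move=> k x y; rewrite /GRing.add/= Tl Sl scalerDr addrACA.
  exists (M + N) => x; rewrite mulrDl (le_trans (ler_normD _ _))// lerD//.
- move=> k T /asboolP[Tl [M TM]]; apply/asboolP; split.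
    move=> a x y; change (k *: T (a *: x + y) = a *: (k *: T x) + k *: T y).
    by rewrite Tl scalerDr !scalerA (mulrC k).
  by exists (`|k| * M) => x; rewrite normrZ -mulrA ler_wpM2l.
Qed.
HB.instance Definition _ :=
  GRing.isSubmodClosed.Build R[i] (H -> H) bounded_op bounded_op_closed.
HB.instance Definition _ := [SubChoice_isSubLmodule of bounded_operator by <:].

Lemma bopP T S : (forall x, T x = S x) -> T = S.
Proof. by move=> TS; apply/val_inj/funext. Qed.

Lemma bop_ext x y : (forall v, '[v, x] = '[v, y]) -> x = y.
Proof.
move=> xy; apply/eqP; rewrite -subr_eq0 -normr_eq0 -sqrf_eq0 norm_inner.
by rewrite linearBr/= xy subrr.
Qed.

Let id_bounded : id \in bounded_op.
Proof. by apply/asboolP; split=> //; exists 1 => x; rewrite mul1r. Qed.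
Let one := BoundedOperator id_bounded.

Let comp_bounded T S : T \o S \in bounded_op.
Proof.
apply/asboolP; split; first by move=> k x y; rewrite /= !bop_linear.
have [M M0 TM] := bop_bounded T; have [N N0 SN] := bop_bounded S.
exists (M * N) => x; rewrite (le_trans (TM _))// -mulrA ler_wpM2l//.
Qed.
Let mul T S := BoundedOperator (comp_bounded T S).

Lemma adjoint_exists T :
  {S : bounded_operator | forall x y, '[T x, y] = '[x, S y]}.
Proof.
apply/cid; have [M M0 TM] := bop_bounded T.
have /choice[S SE] : forall y, exists z, forall x, '[T x, y] = '[x, z].
  move=> y; apply: (@Riesz R H (fun x => '[T x, y]) (M * `|y|)).
    by move=> k x z; rewrite bop_linear linearDl linearZl.
  move=> x; rewrite (le_trans (CauchySchwarz_inner _ _))// mulrAC.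
  by rewrite ler_wpM2r.
have Sb : S \in bounded_op.
  apply/asboolP; split.
    move=> k x y; apply: bop_ext => v.
    by rewrite -SE !linearDr !linearZr/= !SE.
  exists M => y; have [->|Sy0] := eqVneq (S y) 0.
    by rewrite normr0 mulr_ge0.
  have Sy : 0 < `|S y| by rewrite normr_gt0.
  rewrite -(ler_pM2l Sy) -expr2 norm_inner -SE -[leLHS]ger0_norm; last first.
    by rewrite SE -norm_inner exprn_ge0.
  rewrite (le_trans (CauchySchwarz_inner _ _))// mulrA ler_wpM2r//.
  by rewrite mulrC.
by exists (BoundedOperator Sb) => x y; rewrite SE.
Qed.

Definition adjoint T := sval (adjoint_exists T).

Lemma adjointE T x y : '[T x, y] = '[x, adjoint T y].
Proof. exact: (svalP (adjoint_exists T)). Qed.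

Lemma adjointEr T x y : '[adjoint T x, y] = '[x, T y].
Proof. by rewrite innerC -adjointE -innerC. Qed.

Let mulA : associative mul. Proof. by move=> T S U; apply: bopP. Qed.
Let mul1 : left_id one mul. Proof. by move=> T; apply: bopP. Qed.
Let mulr1 : right_id one mul. Proof. by move=> T; apply: bopP. Qed.
Let mulDl : left_distributive mul +%R.
Proof. by move=> T S U; apply: bopP. Qed.
Let mulDr : right_distributive mul +%R.
Proof.
move=> T S U; apply: bopP => x.
by have := bop_linear T 1 (S x) (U x); rewrite !scale1r.
Qed.
Let mulZl (k : R[i]) T S : mul (k *: T) S = k *: mul T S.
Proof. exact: bopP. Qed.
Let bop0 T : T 0 = 0.
Proof. by have := bop_linear T (-1) 0 0; rewrite !scaleN1r oppr0 addr0 addNr. Qed.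
Let mulZr (k : R[i]) T S : mul T (k *: S) = k *: mul T S.
Proof.
by apply: bopP => x; have := bop_linear T k (S x) 0; rewrite bop0 !addr0.
Qed.
Let adjK : involutive adjoint.
Proof.
by move=> T; apply: bopP => y; apply: bop_ext => x; rewrite -adjointE adjointEr.
Qed.
Let adjD : {morph adjoint : T S / T + S}.
Proof.
move=> T S; apply: bopP => y; apply: bop_ext => x.
rewrite -adjointE [RHS]linearDr/= -!adjointE.
by rewrite -linearDl.
Qed.
Let adjZ (k : R[i]) T : adjoint (k *: T) = k^* *: adjoint T.
Proof.
apply: bopP => y; apply: bop_ext => x.
by rewrite -adjointE [RHS]linearZr/= conjCK -adjointE -linearZl.
Qed.
Let adjM T S : adjoint (mul T S) = mul (adjoint S) (adjoint T).
Proof.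
by apply: bopP => y; apply: bop_ext => x; rewrite -adjointE /= -!adjointE.
Qed.

HB.instance Definition _ := isStarAlgebra.Build R bounded_operator
  mulA mul1 mulr1 mulDl mulDr mulZl mulZr adjK adjD adjZ adjM.
HB.instance Definition _ :=
  GRing.PzRing.copy bounded_operator (bounded_operator : starAlgType R).
End BoundedOperators.

(* A commutative C*-subalgebra: a norm-closed commutative unital *-subalgebra. *)
Record commCstarSubalg (R : realType) (A : cstarAlgType R) := CommCstarSubalg {
  comm_subalg : starSubalg A;
  comm_subalg_closed : closed (subalg_set comm_subalg);
  comm_subalg_comm : forall x y,
    subalg_set comm_subalg x -> subalg_set comm_subalg y -> x * y = y * x
}.

Definition comm_type (R : realType) (A : cstarAlgType R)
  (C : commCstarSubalg A) : Type := subalg_type (comm_subalg C).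
Coercion comm_type : commCstarSubalg >-> Sortclass.
HB.instance Definition _ (R : realType) (A : cstarAlgType R)
  (C : commCstarSubalg A) := StarAlgebra.on (comm_type C).
HB.instance Definition _ (R : realType) (A : cstarAlgType R)
  (C : commCstarSubalg A) :=
  GRing.PzRing.copy (comm_type C) (comm_type C : starAlgType R).

Definition comm_incl (R : realType) (A : cstarAlgType R)
  (C : commCstarSubalg A) (c : C) : A := subalg_val c.

(* The points of the Gelfand spectrum; its topology plays no role below. *)
Definition spectrum (R : realType) (A : cstarAlgType R)
  (C : commCstarSubalg A) : Type := {starhom comm_type C -> R[i]}.

Section Gelfand.
Variables (R : realType) (A : cstarAlgType R) (C : commCstarSubalg A).

Definition evaluation (c : C) : spectrum C -> R[i] := fun chi => chi c.

Lemma evaluation_bounded (c : C) : bounded_funs (evaluation c).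
Proof.
by exists `|comm_incl c| => chi; exact/character_le/comm_subalg_closed.
Qed.

(* The composite C -> C(Spec C) -> l^oo(Spec C) of the Gelfand transform and
   the inclusion. *)
Definition gelfand (c : C) : linfty R (spectrum C) :=
  subalg_elt (evaluation_bounded c : subalg_set (bounded_subalg R _) _).
End Gelfand.

(* For projections, p <= q means p * q = p. *)
Definition is_proj_lub (R : realType) (A : starAlgType R) (P : set A) (s : A) :
    Prop :=
  [/\ is_proj s, forall p, P p -> p * s = p &
      forall q, is_proj q -> (forall p, P p -> p * q = p) -> s * q = s].

(* The condition for a *-homomorphism of AW*-algebras to be a morphism of
   AWstar.  It only involves the *-algebra structures, so it makes sense as it
   stands for linfty R X, which is not equipped with its norm here. *)
Definition is_AWstar_morphism (R : realType) (A B : starAlgType R)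
    (f : {starhom A -> B}) : Prop :=
  forall (P : set A) (s : A), P `<=` is_proj (A := A) ->
    is_proj_lub P s -> is_proj_lub (f @` P) (f s).

Definition is_AWstar_discretization (R : realType) (A : cstarAlgType R)
    (M : awstarAlgType R) (phi : {starhom A -> M}) : Prop :=
  forall C : commCstarSubalg A,
  exists2 phiC : {starhom linfty R (spectrum C) -> M},
    is_AWstar_morphism phiC &
    forall c : C, phi (comm_incl c) = phiC (gelfand c).

Definition finite_dimensional (K : pzRingType) (V : lmodType K) : Prop :=
  exists (n : nat) (e : 'I_n -> V),
    forall v, exists a : 'I_n -> K, v = \sum_(i < n) a i *: e i.

(* Main.v *)
Require Import Defs.
From mathcomp Require Import all_boot all_order all_algebra.
From mathcomp Require Import complex finmap lra.
From mathcomp Require Import all_classical all_reals all_analysis.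
Set Implicit Arguments.
Unset Strict Implicit.
Unset Printing Implicit Defensive.
Import Order.TTheory GRing.Theory Num.Theory.
Import numFieldNormedType.Exports.
Local Open Scope classical_set_scope.
Local Open Scope ring_scope.

(** An infinite-dimensional [H] is isomorphic to [H + H], so [B(H)] contains two
    isometries with complementary ranges, and hence selfadjoint unitaries
    [u_n], [v_n] (a copy of the CAR algebra) such that [u_m], [v_n] anticommute
    for [m = n] and all other pairs commute.  Let [C] and [D] be commutative
    subalgebras of [A] containing the images of the [u_n] and of the [v_n].  The
    point masses of [l^oo(Spec C)] and [l^oo(Spec D)] give families of
    projections [P chi] and [Q psi] of [M], each with supremum [1].  If [E_k] is
    the spectral projection of [u_0, ..., u_(k-1)] attached to [chi], then
    [P chi <= E_k] while anticommutation gives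
    [Q psi * E_k * Q psi = 2^-k * Q psi].  Thus [P chi * Q psi = 0] for all
    [chi] and [psi], and taking suprema yields [1 = 0] in [M]. *)

(** * Projections separated by anticommuting symmetries *)

Section AnticommutingSymmetries.
Variables (R : realType) (M : cstarAlgType R) (U V : nat -> M) (p q : M).
Hypotheses (UU : forall n, U n * U n = 1) (starU : forall n, star (U n) = U n).
Hypothesis commU : forall m n, U m * U n = U n * U m.
Hypothesis commUV : forall m n, (m < n)%N -> U m * V n = V n * U m.
Hypothesis anticommUV : forall n, U n * V n = - (V n * U n).
Hypotheses (proj_p : is_proj p) (proj_q : is_proj q).
Hypotheses (Up : forall n, U n * p = p) (Vq : forall n, V n * q = q).
Hypothesis starV : forall n, star (V n) = V n.

Let half (x : M) : M := 2^-1 *: (1 + x).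

(** For a symmetry [x], [half x] projects onto its eigenspace for eigenvalue 1. The [U i] commute,
    so this product projects onto the joint eigenspace of [U 0], ..., [U (k - 1)] for eigenvalue
    1. *)
Fixpoint spectral_proj k : M :=
  if k is k'.+1 then spectral_proj k' * half (U k') else 1.
Local Notation E := spectral_proj.

Let half_double (x : M) : 2^-1 *: (x + x) = x.
Proof.
by rewrite -[x in x + x]scale1r -scalerDl scalerA mulVf ?scale1r// (pnatr_eq0 _ 2).
Qed.

Let half_comm x y : x * y = y * x -> half x * y = y * half x.
Proof.
by move=> xy; rewrite -star_scaleAl -star_scaleAr mulrDl mulrDr mul1r mulr1 xy.
Qed.

Let halfK n : half (U n) * half (U n) = half (U n).
Proof.
rewrite -star_scaleAl -star_scaleAr mulrDl mul1r mulrDr mulr1 UU.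
by rewrite -[U n + 1]addrC half_double.
Qed.

Let star_half n : star (half (U n)) = half (U n).
Proof.
rewrite /half starZ starD star1 starU; congr (_ *: _).
by rewrite conj_Creal// rpredV realn.
Qed.

Lemma spectral_proj_comm x k : (forall m, (m < k)%N -> U m * x = x * U m) ->
  E k * x = x * E k.
Proof.
elim: k => [|k IH] Ux /=; first by rewrite mul1r mulr1.
rewrite -mulrA half_comm; last exact: Ux.
by rewrite !mulrA IH// => m mk; apply: Ux; rewrite ltnW.
Qed.

Let E_half k n : E k * half (U n) = half (U n) * E k.
Proof. by apply: spectral_proj_comm => m _; apply/esym/half_comm/commU. Qed.

Lemma spectral_proj_is_proj k : is_proj (E k).
Proof.
elim: k => [|k [EE starE]] /=; first by split; rewrite ?mulr1 ?star1.
split; last by rewrite starM star_half starE E_half.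
by rewrite mulrA -(mulrA (E k)) -E_half mulrA EE -mulrA halfK.
Qed.

Lemma spectral_proj_le k : E k * p = p.
Proof.
elim: k => [|k IH] /=; first by rewrite mul1r.
by rewrite -mulrA -star_scaleAl mulrDl mul1r Up half_double.
Qed.

(** Each new factor [half (U k)] splits in two: its constant term halves the previous value, and its
    [U k] term vanishes because it equals its own negative. *)
Lemma spectral_proj_compress k : q * (E k * q) = 2^-1 ^+ k *: q.
Proof.
have qV n : q * V n = q.
  by have := congr1 star (Vq n); rewrite starM starV proj_q.2.
elim: k => [|k IH] /=; first by rewrite expr0 scale1r mul1r proj_q.1.
(* [V k] fixes [q], commutes with [E k] and anticommutes with [U k]. *)
have Z : q * (E k * (U k * q)) = 0.
  have S : q * (E k * (U k * q)) = - (q * (E k * (U k * q))).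
    rewrite -{1}(qV k) -mulrA (mulrA (V k)) -spectral_proj_comm.
      by rewrite -mulrA (mulrA (V k)) -[V k * U k]opprK -anticommUV mulNr -mulrA Vq !mulrN.
    by move=> m; exact: commUV.
  by rewrite -[LHS]half_double {1}S addNr scaler0.
rewrite -mulrA -star_scaleAl -!star_scaleAr mulrDl mul1r !mulrDr Z addr0 IH.
by rewrite scalerA exprS.
Qed.

(** Since [p] lies below [E k], [p * q = p * (E k * q)]. The C*-identity turns the squared norm of
    [E k * q] into the norm of [q * E k * q], which decays like [2^-k]. *)
Lemma anticommuting_symmetries_orth : p * q = 0.
Proof.
apply/eqP; rewrite -normr_eq0 -sqrf_eq0 -normr_le0 normrX normr_id.
have bound k : `|p * q| ^+ 2 <= 2^-1 ^+ k * (`|p| ^+ 2 * `|q|).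
  have -> : p * q = p * (E k * q).
    rewrite mulrA; congr (_ * _).
    have := congr1 star (spectral_proj_le k).
    by rewrite starM (spectral_proj_is_proj k).2 proj_p.2.
  have -> : 2^-1 ^+ k * (`|p| ^+ 2 * `|q|) = `|p| ^+ 2 * `|E k * q| ^+ 2.
    rewrite -(norm_star_mul (E k * q)) -[alg_mul _ _]/(star (E k * q) * (E k * q)).
    have [EE Es] := spectral_proj_is_proj k.
    rewrite starM proj_q.2 Es -mulrA (mulrA (E k)) EE spectral_proj_compress normrZ.
    by rewrite normrX ger0_norm ?invr_ge0// mulrCA.
  rewrite -exprMn lerXn2r ?nnegrE ?mulr_ge0//; exact: norm_alg_mul.
set K := `|p| ^+ 2 * `|q| in bound; have K0 : 0 <= K by rewrite mulr_ge0 ?exprn_ge0.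
rewrite -[_ <= 0]negbK -real_ltNge ?real0 ?rpredX ?normr_real//.
apply/negP => c0.
(* [K] may be zero, so the division is by [K + 1]. *)
have K1 : 0 < K + 1 by rewrite ltr_wpDl.
have [k] : exists k, 2^-1 ^+ k < `|p * q| ^+ 2 / (K + 1) :> R[i].
  by apply: complex_geo_small; rewrite ?invr_ge0 ?invf_lt1 ?ltr1n// divr_gt0.
rewrite ltr_pdivlMr// => /lt_le_trans/(_ (bound k)).
by rewrite ltr_pM2l ?exprn_gt0 ?invr_gt0// gtrDl ltr10.
Qed.
End AnticommutingSymmetries.

(** * Commutative subalgebras and discretizations *)

Section DoubleCommutant.
Variables (R : realType) (A : cstarAlgType R).
Implicit Types S : set A.

Definition commutant S : set A := [set x | forall s, S s -> x * s = s * x].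

(** If [y] commutes with [s], then [x] and [x - y] have the same commutator with [s], of norm at
    most [2 |s| |x - y|]. The divisor [2 |s| + 1] stays positive when [s = 0]. *)
Lemma closed_commutant S : closed (commutant S).
Proof.
move=> x clx s Ss; apply/eqP; rewrite -subr_eq0 -normr_le0.
apply: contraT; rewrite -real_ltNge ?normr_real// => d0.
have e0 : 0 < `|x * s - s * x| / (2 * `|s| + 1).
  by rewrite divr_gt0// ltr_wpDl// mulr_ge0.
have [y [Sy]] := clx _ (nbhsx_ballx _ _ e0).
rewrite -ball_normE/= ltr_pdivlMr ?ltr_wpDl ?mulr_ge0// => xy.
have E : x * s - s * x = (x - y) * s - s * (x - y).
  by rewrite mulrBl mulrBr Sy// opprB addrA subrK.
have : `|x * s - s * x| <= `|x - y| * (2 * `|s| + 1).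
  have le2 : `|x - y| * `|s| + `|s| * `|x - y| <= `|x - y| * (2 * `|s| + 1).
    by rewrite mulrDr mulr1 mulrCA mulr2n mulrDl !mul1r (mulrC `|s|) lerDl.
  rewrite E (le_trans (ler_normB _ _))// (le_trans _ le2)// lerD//; exact: norm_alg_mul.
by move=> /le_lt_trans/(_ xy); rewrite ltxx.
Qed.

Variables (S : set A).
Hypothesis starS : forall s, S s -> S (star s).

Lemma commutant_star x : commutant S x -> commutant S (star x).
Proof.
move=> Sx s Ss; apply: (inv_inj (@starK _ A)).
by rewrite !starM !starK Sx//; exact: starS.
Qed.

Definition commutant_subalg : starSubalg A.
Proof.
exists (commutant S) => [s _|x y Sx Sy s Ss|k x Sx s Ss|x y Sx Sy s Ss|x Sx].
- by rewrite mul1r mulr1.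
- by rewrite mulrDl mulrDr Sx// Sy.
- by rewrite -star_scaleAl -star_scaleAr Sx.
- by rewrite -mulrA Sy// mulrA Sx// mulrA.
- exact: commutant_star.
Defined.
End DoubleCommutant.

Section CommutingFamily.
Variables (R : realType) (A : cstarAlgType R) (u : nat -> A).
Hypotheses (star_u : forall n, star (u n) = u n).
Hypothesis comm_u : forall m n, u m * u n = u n * u m.

(* The double commutant is closed and commutative, which avoids taking the norm
   closure of the generated *-algebra. *)
Lemma commCstarSubalg_of_commuting :
  exists C : commCstarSubalg A, forall n, subalg_set (comm_subalg C) (u n).
Proof.
have starS : forall s, commutant (range u) s -> commutant (range u) (star s).
  by apply: commutant_star => _ [n _ <-]; exists n.
have uS n : commutant (range u) (u n) by move=> _ [m _ <-].
have closedS := @closed_commutant R A (commutant (range u)).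
(* The [u n] lie in their own commutant, so every element of the double commutant commutes with them
   and hence lies in the commutant, with which the double commutant commutes. *)
have commS x y : commutant (commutant (range u)) x ->
    commutant (commutant (range u)) y -> x * y = y * x.
  by move=> Sx Sy; apply: Sx => _ [n _ <-]; exact/Sy/uS.
exists (@CommCstarSubalg _ _ (commutant_subalg starS) closedS commS) => n x Sx.
by rewrite -Sx//; exists n.
Qed.
End CommutingFamily.

(** * Images of point masses under a discretization *)

Section Atoms.
Variables (R : realType) (A : cstarAlgType R) (M : awstarAlgType R).
Variable phi : {starhom A -> M}.
Hypothesis hphi : is_AWstar_discretization phi.

Section PointMass.
Variable X : Type.
Implicit Types x y : X.

Let delta x : X -> R[i] := fun y => if `[< y = x >] then 1 else 0.

Let delta_bounded x : bounded_funs (delta x).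
Proof. by exists 1 => y; rewrite /delta; case: ifP; rewrite ?normr1 ?normr0. Qed.

Definition point_mass x : linfty R X :=
  subalg_elt (delta_bounded x : subalg_set (bounded_subalg R X) _).

Lemma linftyP (f g : linfty R X) : (forall x, subalg_val f x = subalg_val g x) -> f = g.
Proof. by move=> fg; apply/val_inj/funext. Qed.

Lemma point_mass_proj x : is_proj (point_mass x).
Proof.
split; apply: linftyP => y /=; rewrite /delta.
  change (delta x y * delta x y = delta x y).
  by rewrite /delta; case: ifP; rewrite ?mulr1 ?mulr0.
change ((delta x y)^* = delta x y).
by rewrite /delta; case: ifP; rewrite ?conjC1 ?conjC0.
Qed.

Lemma mul_point_mass (f : linfty R X) x :
  f * point_mass x = subalg_val f x *: point_mass x.
Proof.
apply: linftyP => y.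
change (subalg_val f y * delta x y = subalg_val f x * delta x y).
by rewrite /delta; case: asboolP => [->|]; rewrite ?mulr0.
Qed.

Lemma point_mass_lub : is_proj_lub (range point_mass) 1.
Proof.
split; first by split; [rewrite mulr1|rewrite star1].
  by move=> ? _; rewrite mulr1.
move=> q _ qP; rewrite mul1r; apply: linftyP => x.
have := congr1 (fun f : linfty R X => subalg_val f x) (qP _ (ex_intro2 _ _ x I erefl)).
change (delta x x * subalg_val q x = delta x x -> subalg_val q x = 1).
by rewrite /delta asboolT// mul1r.
Qed.
End PointMass.

(** [P chi] is the image of the point mass at [chi]. The eigenvalue relation is the image of
    [f * delta_x = f(x) delta_x], and the last clause says that the supremum 1 of the atoms is
    preserved. *)
Lemma discretization_atoms (C : commCstarSubalg A) : exists P : spectrum C -> M,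
  [/\ forall chi, is_proj (P chi),
      forall chi c, phi (comm_incl c) * P chi = chi c *: P chi &
      forall r, is_proj r -> (forall chi, P chi * r = 0) -> r = 0].
Proof.
have [phiC phiC_lub phiCE] := hphi C.
have [_ Ple P1] := phiC_lub _ _ (fun _ '(ex_intro2 x _ e) =>
   eq_ind _ _ (point_mass_proj x) _ e) (point_mass_lub (spectrum C)).
exists (fun chi => phiC (point_mass chi)); split=> [chi|chi c|r [rr sr] Pr].
- have [pp sp] := point_mass_proj chi.
  by split; [rewrite -rmorphM/= pp|rewrite -starhom_star sp].
- by rewrite phiCE -rmorphM/= mul_point_mass linearZ.
(* [1 - r] dominates every [P chi], hence their supremum 1, which forces [r = 0]. *)
have r1 : is_proj (1 - r).
  split; last by rewrite starD starN star1 sr.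
  by rewrite mulrBr mulr1 mulrBl mul1r rr subrr subr0.
have := P1 _ r1; rewrite rmorph1 mul1r => /(_ _)/esym/eqP.
rewrite -subr_eq0 opprB addrCA subrr addr0 => E; apply/eqP/E.
by move=> _ [_ [chi _ <-] <-]; rewrite mulrBr mulr1 Pr subr0.
Qed.
End Atoms.

(** * Symmetries from a pair of Cuntz isometries *)

Section CuntzSymmetries.
Variables (R : realType) (B : starAlgType R) (s1 s2 : B).
Hypotheses (s11 : star s1 * s1 = 1) (s22 : star s2 * s2 = 1).
Hypotheses (s12 : star s1 * s2 = 0) (s1s2 : s1 * star s1 + s2 * star s2 = 1).

Let s21 : star s2 * s1 = 0.
Proof. by apply: (inv_inj (@starK _ B)); rewrite starM starK s12 star0. Qed.

(** The canonical endomorphism of the Cuntz algebra. As two-by-two matrices over the ranges of [s1]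
    and [s2], [cuntz_endo x] is diagonal with both entries [x], while [cuntz_swap] and [cuntz_sign]
    are the Pauli matrices X and Z, which commute with it. *)
Definition cuntz_endo (x : B) : B := s1 * x * star s1 + s2 * x * star s2.
Local Notation lam := cuntz_endo.
Definition cuntz_swap : B := s1 * star s2 + s2 * star s1.
Definition cuntz_sign : B := s1 * star s1 - s2 * star s2.

Let mid (a b c d x : B) : star b * c = x -> (a * star b) * (c * d) = a * x * d.
Proof. by move=> <-; rewrite !mulrA. Qed.

Let mid1 (a b d : B) : star b * b = 1 -> (a * star b) * (b * d) = a * d.
Proof. by move=> /mid->; rewrite mulr1. Qed.

Let mid0 (a b c d : B) : star b * c = 0 -> (a * star b) * (c * d) = 0.
Proof. by move=> /mid->; rewrite mulr0 mul0r. Qed.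

Let rules := (fun a d => mid1 a d s11, fun a d => mid1 a d s22,
  fun a d => mid0 a d s12, fun a d => mid0 a d s21).

Let lamE x : lam x = s1 * (x * star s1) + s2 * (x * star s2).
Proof. by rewrite /lam !mulrA. Qed.

Lemma cuntz_endoM x y : lam (x * y) = lam x * lam y.
Proof.
by rewrite [lam y]lamE /lam mulrDl !mulrDr !rules addr0 add0r !mulrA.
Qed.

Lemma cuntz_endo1 : lam 1 = 1. Proof. by rewrite /lam !mulr1. Qed.

Lemma cuntz_endoN x : lam (- x) = - lam x.
Proof. by rewrite /lam !mulrN !mulNr opprD. Qed.

Lemma cuntz_endo_star x : star (lam x) = lam (star x).
Proof. by rewrite /lam starD !starM !starK !mulrA. Qed.

Lemma cuntz_swapK : cuntz_swap * cuntz_swap = 1.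
Proof. by rewrite /cuntz_swap mulrDl !mulrDr !rules addr0 add0r. Qed.

Lemma cuntz_signK : cuntz_sign * cuntz_sign = 1.
Proof. by rewrite /cuntz_sign mulrBl !mulrBr !rules subr0 sub0r opprK. Qed.

Lemma cuntz_swap_sign : cuntz_swap * cuntz_sign = - (cuntz_sign * cuntz_swap).
Proof.
rewrite /cuntz_swap /cuntz_sign mulrDl mulrBl !mulrBr !mulrDr !rules.
by rewrite !addr0 !add0r subr0 opprB addrC.
Qed.

Lemma cuntz_endo_swap x : lam x * cuntz_swap = cuntz_swap * lam x.
Proof.
rewrite {2}lamE /lam /cuntz_swap !mulrDl !mulrDr !rules !addr0 !add0r addrC.
by rewrite !mulrA addrC.
Qed.

Lemma cuntz_endo_sign x : lam x * cuntz_sign = cuntz_sign * lam x.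
Proof.
rewrite {2}lamE /lam /cuntz_sign mulrDl mulrBl !mulrBr !mulrDr !rules.
by rewrite !addr0 !add0r ?subr0 ?sub0r !mulrA.
Qed.

Let iter_lam n (f : B -> B) : (forall x, lam (f x) = f (lam x)) ->
  forall x, iter n lam (f x) = f (iter n lam x).
Proof. by move=> lf x; elim: n => //= n ->. Qed.

Lemma iter_cuntz_endoM n x y : iter n lam (x * y) = iter n lam x * iter n lam y.
Proof. by elim: n => //= n ->; rewrite cuntz_endoM. Qed.

Let iter1 n : iter n lam 1 = 1.
Proof. by elim: n => //= n ->; exact: cuntz_endo1. Qed.

Let iter_comm x y m n : (m < n)%N -> (forall z, lam z * y = y * lam z) ->
  iter n lam x * iter m lam y = iter m lam y * iter n lam x.
Proof.
(* Pulling out [m] copies of [lam] leaves [y] against an element with at least one [lam] on the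
   outside. *)
move=> mn xy; have -> : n = (m + (n - m.+1).+1)%N by rewrite addnS -addSn subnKC.
by rewrite iterD -!iter_cuntz_endoM iterS xy.
Qed.

(** [cuntz_u n] and [cuntz_v n] act as the Pauli matrices X and Z on the [n]-th factor of an
    infinite tensor power of two-by-two matrices. Equal levels anticommute and distinct levels
    commute. *)
Definition cuntz_u n := iter n lam cuntz_swap.
Definition cuntz_v n := iter n lam cuntz_sign.

Lemma cuntz_symmetries :
  [/\ forall n, star (cuntz_u n) = cuntz_u n /\ cuntz_u n * cuntz_u n = 1,
      forall n, star (cuntz_v n) = cuntz_v n /\ cuntz_v n * cuntz_v n = 1,
      (forall m n, cuntz_u m * cuntz_u n = cuntz_u n * cuntz_u m) /\
      (forall m n, cuntz_v m * cuntz_v n = cuntz_v n * cuntz_v m),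
      forall m n, (m < n)%N -> cuntz_u m * cuntz_v n = cuntz_v n * cuntz_u m &
      forall n, cuntz_u n * cuntz_v n = - (cuntz_v n * cuntz_u n)].
Proof.
have star_iter n x : star x = x -> star (iter n lam x) = iter n lam x.
  by move=> xs; rewrite -(iter_lam n (fun x => esym (cuntz_endo_star x))) xs.
have comm f : (forall z, lam z * f = f * lam z) ->
    forall m n, iter m lam f * iter n lam f = iter n lam f * iter m lam f.
  move=> lf m n; have [mn|nm|->//] := ltngtP m n; first exact/esym/iter_comm.
  exact: iter_comm.
split=> [n|n||m n mn|n].
- split; last by rewrite -iter_cuntz_endoM cuntz_swapK iter1.
  by apply: star_iter; rewrite starD !starM !starK addrC.
- split; last by rewrite -iter_cuntz_endoM cuntz_signK iter1.
  by apply: star_iter; rewrite starD starN !starM !starK.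
- split; apply: comm; [exact: cuntz_endo_swap|exact: cuntz_endo_sign].
- by apply/esym/iter_comm => //; exact: cuntz_endo_swap.
- rewrite -!iter_cuntz_endoM cuntz_swap_sign.
  by rewrite (iter_lam n (fun x => cuntz_endoN x)).
Qed.
End CuntzSymmetries.

(** This separates the algebra from the Hilbert space geometry: [B] enters only through its two
    Cuntz isometries. *)
Theorem cuntz_discretization_trivial (R : realType) (B : starAlgType R)
    (s1 s2 : B) (A : cstarAlgType R) (pi : {starhom B -> A})
    (M : awstarAlgType R) (phi : {starhom A -> M}) :
  star s1 * s1 = 1 -> star s2 * s2 = 1 -> star s1 * s2 = 0 ->
  s1 * star s1 + s2 * star s2 = 1 ->
  is_AWstar_discretization phi -> forall x : M, x = 0.
Proof.
move=> s11 s22 s12 s1s2 hphi.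
have [uP vP [comm_u comm_v] comm_uv anti_uv] := cuntz_symmetries s11 s22 s12 s1s2.
move: (cuntz_u s1 s2) (cuntz_v s1 s2) uP vP comm_u comm_v comm_uv anti_uv.
move=> u v uP vP comm_u comm_v comm_uv anti_uv.
have star_pi x : star x = x -> star (pi x) = pi x by rewrite -starhom_star => ->.
have pi_comm x y : x * y = y * x -> pi x * pi y = pi y * pi x.
  by move=> xy; rewrite -!rmorphM xy.
have [C Cu] := @commCstarSubalg_of_commuting R A (fun n => pi (u n))
  (fun n => star_pi _ (uP n).1) (fun m n => pi_comm _ _ (comm_u m n)).
have [D Dv] := @commCstarSubalg_of_commuting R A (fun n => pi (v n))
  (fun n => star_pi _ (vP n).1) (fun m n => pi_comm _ _ (comm_v m n)).
have [P [Pproj PE P0]] := discretization_atoms hphi C.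
have [Q [Qproj QE Q0]] := discretization_atoms hphi D.
pose f x := phi (pi x).
have fM x y : f (x * y) = f x * f y by rewrite /f !rmorphM.
(* A character takes a symmetry to a sign. *)
have char_sign (E : commCstarSubalg A) (chi : spectrum E) w
    (Ew : subalg_set (comm_subalg E) (pi w)) : star w = w -> w * w = 1 ->
    let t := chi (subalg_elt Ew) in t^* = t /\ t * t = 1.
  move=> ws ww t; split.
    rewrite -[LHS](starhom_star (s := chi)); congr (chi _); apply/val_inj.
    by rewrite /= star_pi.
  rewrite -rmorphM -(rmorph1 chi); congr (chi _); apply/val_inj.
  by rewrite /= -rmorphM ww rmorph1.
have PQ chi psi : P chi * Q psi = 0.
  pose t n := chi (subalg_elt (Cu n)); pose r n := psi (subalg_elt (Dv n)).
  have tP n : (t n)^* = t n /\ t n * t n = 1 by apply: char_sign; case: (uP n).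
  have rP n : (r n)^* = r n /\ r n * r n = 1 by apply: char_sign; case: (vP n).
  have ZZ a b x y : (a *: f x) * (b *: f y) = (a * b) *: f (x * y).
    by rewrite -star_scaleAl -star_scaleAr scalerA fM.
  (* Multiplying by the signs [t n] and [r n] makes [P chi] and [Q psi] fixed by the symmetries, and
     preserves all their relations. *)
  apply: (@anticommuting_symmetries_orth R M (fun n => t n *: f (u n))
    (fun n => r n *: f (v n))) => // [n|n|m n|m n mn|n|n|n|n].
  - by rewrite ZZ (tP n).2 (uP n).2 scale1r /f !rmorph1.
  - by rewrite starZ (tP n).1 -!starhom_star (uP n).1.
  - by rewrite !ZZ comm_u mulrC.
  - by rewrite !ZZ comm_uv// mulrC.
  - by rewrite !ZZ anti_uv mulrC /f !rmorphN scalerN.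
  - by rewrite -star_scaleAl (PE chi (subalg_elt (Cu n))) scalerA (tP n).2 scale1r.
  - by rewrite -star_scaleAl (QE psi (subalg_elt (Dv n))) scalerA (rP n).2 scale1r.
  - by rewrite starZ (rP n).1 -!starhom_star (vP n).1.
(* The supremum property is used twice: for [P] against [Q psi], then for [Q] against the projection
   1. *)
have Q1 psi : Q psi = 0 by exact: P0.
have one0 : 1 = 0 :> M.
  by apply: Q0 => [|psi]; [split; rewrite ?mulr1 ?star1|rewrite Q1 mul0r].
by move=> x; rewrite -[x]mulr1 one0 mulr0.
Qed.

(** * Cuntz isometries on an infinite-dimensional Hilbert space *)

Section OrthonormalFamilies.
Variables (R : realType) (H : hilbertType R).
Local Notation "'[ x , y ]" := (@inner R H x y).
Implicit Types x y v : H.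

Definition orthonormal_family (J : eqType) (e : J -> H) :=
  forall i j, '[e i, e j] = (i == j)%:R.

Definition total_family (J : Type) (e : J -> H) :=
  forall v, (forall j, '[v, e j] = 0) -> v = 0.

Lemma inner_suml (I : Type) (s : seq I) (P : pred I) (F : I -> H) y :
  '[\sum_(i <- s | P i) F i, y] = \sum_(i <- s | P i) '[F i, y].
Proof.
elim/big_rec2: _ => [|i a b _ <-]; first by rewrite linear0l.
by rewrite linearDl.
Qed.

Lemma inner_eq0 x : '[x, x] = 0 -> x = 0.
Proof. by rewrite -norm_inner => /eqP; rewrite sqrf_eq0 normr_eq0 => /eqP. Qed.

Section FiniteSums.
Variables (J : choiceType) (e : J -> H).
Hypothesis eP : orthonormal_family e.
Variable c : J -> R[i].

Lemma inner_orthonormal_sum (A : {fset J}) j :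
  '[\sum_(i <- A) c i *: e i, e j] = if j \in A then c j else 0.
Proof.
rewrite inner_suml; case: ifPn => jA.
  rewrite (big_fsetD1 j)//= linearZl/= eP eqxx mulr1 big1_fset ?addr0// => i.
  by rewrite !inE => /andP[ij _] _; rewrite linearZl/= eP (negPf ij) mulr0.
rewrite big1_fset// => i iA _; rewrite linearZl/= eP.
by case: eqP jA => [<-|_]; rewrite ?iA// mulr0.
Qed.

Lemma norm_orthonormal_sum (A : {fset J}) :
  `|\sum_(i <- A) c i *: e i| ^+ 2 = \sum_(i <- A) `|c i| ^+ 2.
Proof.
rewrite norm_inner [X in '[X, _]](eq_bigr (fun i => c i *: e i))// inner_suml.
rewrite big_seq [RHS]big_seq; apply: eq_bigr => i iA.
rewrite linearZl/= innerC inner_orthonormal_sum iA normCK; congr (_ * _).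
Qed.

End FiniteSums.

(** Expand the squared norm of [x - s], where [s] is the orthogonal projection of [x] onto the span;
    every inner product involving [s] equals [N]. *)
Lemma Bessel (J : choiceType) (e : J -> H) x (A : {fset J}) :
  orthonormal_family e ->
  \sum_(i <- A) `|'[x, e i]| ^+ 2 <= `|x| ^+ 2.
Proof.
move=> eP; set s := \sum_(i <- A) '[x, e i] *: e i; set N := \sum_(i <- A) _.
have sx : '[s, x] = N.
  rewrite inner_suml; apply: eq_bigr => i _.
  by rewrite linearZl/= (innerC x) normCK.
have Nreal : N^* = N.
  by rewrite conj_Creal// rpred_sum// => i _; rewrite rpredX// normr_real.
have xs : '[x, s] = N by rewrite innerC sx.
have ss : '[s, s] = N by rewrite -norm_inner (norm_orthonormal_sum eP (fun i => '[x, e i])).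
have : 0 <= `|x - s| ^+ 2 by rewrite exprn_ge0.
rewrite norm_inner linearBl !linearBr/= ss sx xs subrr subr0 subr_ge0.
by rewrite norm_inner.
Qed.

(** * Operators carrying one orthonormal family to another *)

Local Open Scope fset_scope.
Local Open Scope ring_scope.

(** [y] is the sum of the ['[x, e j] *: g j] over a possibly uncountable [J]. By Bessel the finite
    sums of squared coefficients have a supremum [m]; finite sets nearly attaining [m] give a Cauchy
    sequence of partial sums. *)
Lemma orthonormal_series (J : choiceType) (e g : J -> H) x :
  orthonormal_family e -> orthonormal_family g ->
  exists y, forall r : R, 0 < r -> exists A : {fset J},
    `|y - \sum_(j <- A) '[x, e j] *: g j| < r%:C%C /\
    (forall j, j \notin A -> `|'[x, e j]| < r%:C%C).
Proof.
move=> eP gP; pose c j := '[x, e j].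
have /choice[w wE] : forall j, exists w : R, `|c j| ^+ 2 = w%:C%C.
  by move=> j; apply/complex_realP; rewrite rpredX// normr_real.
have w0 j : 0 <= w j by rewrite -ler0c -wE exprn_ge0.
pose S (A : {fset J}) := \sum_(j <- A) w j.
have SE (A : {fset J}) : \sum_(j <- A) `|c j| ^+ 2 = (S A)%:C%C.
  by rewrite /S rmorph_sum; apply: eq_bigr => j _; rewrite wE.
have splitS (V : nmodType) (F : J -> V) (A B : {fset J}) : A `<=` B ->
    \sum_(j <- B) F j = \sum_(j <- A) F j + \sum_(j <- B `\` A) F j.
  move=> /fsetIidPr AB; rewrite (big_fsetID _ (mem A)) /=; congr (_ + _).
    by apply: eq_fbigl => j; rewrite !inE/= -{2}AB inE.
  by apply: eq_fbigl => j; rewrite !inE/= andbC.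
have S_mono A B : A `<=` B -> S A <= S B.
  by move=> /splitS AB; rewrite /S AB lerDl sumr_ge0.
have [n2 _ n2E] := complex_norm_real x.
have S_le A : S A <= n2 ^+ 2.
  by have := Bessel x A eP; rewrite SE n2E -rmorphXn lecR.
have supS : has_sup (range S).
  by split; [exists (S fset0), fset0|exists (n2 ^+ 2) => _ [A _ <-]].
pose m := sup (range S).
have S_sup A : S A <= m by apply: sup_upper_bound => //; exists A.
have /choice[A AE] : forall n : nat, exists A, m - n.+1%:R^-1 < S A.
  move=> n; have [|_ [A _ <-] ?] := @sup_adherent _ (range S) n.+1%:R^-1 _ supS.
    by rewrite invr_gt0.
  by exists A.
(* Nesting the sets makes differences of partial sums again orthonormal sums, with squared norm at
   most [m - S (B n)]. *)
pose B := fix B n := if n is n'.+1 then B n' `|` A n else A 0%N.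
have BE n : m - n.+1%:R^-1 < S (B n).
  by apply: (lt_le_trans (AE n)); apply: S_mono; case: n => //= n; exact: fsubsetUr.
have B_mono n k : (n <= k)%N -> B n `<=` B k.
  elim: k => [|k IH]; first by rewrite leqn0 => /eqP->.
  rewrite leq_eqVlt => /orP[/eqP->//|/IH/fsubset_trans]; apply; exact: fsubsetUl.
pose t n := \sum_(j <- B n) c j *: g j.
have dist_t n k : (n <= k)%N -> `|t k - t n| ^+ 2 <= (n.+1%:R^-1)%:C%C.
  move=> /B_mono Bnk; rewrite /t (splitS _ _ _ _ Bnk) addrAC subrr add0r.
  rewrite norm_orthonormal_sum// SE lecR.
  have Bkn : S (B k) = S (B n) + S (B k `\` B n) := splitS _ w _ _ Bnk.
  rewrite -(lerD2l (S (B n))) -Bkn (le_trans (S_sup _))// ltW// -ltrBlDr.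
  exact: BE.
have small (r : R) : 0 < r -> exists N, forall n, (N <= n)%N -> n.+1%:R^-1 < r ^+ 2.
  move=> r0; have [N _ Nr] := near_infty_natSinv_lt (PosNum (exprn_gt0 2 r0)).
  by exists N => n; exact: Nr.
have tcvg : cvg (t @ \oo).
  apply/cauchy_cvgP/cauchy_exP => d d0.
  have [r er] : exists r : R, d = r%:C%C.
    by apply/complex_realP; rewrite gtr0_real.
  have r0 : 0 < r by rewrite -ltcR -er.
  have [N /(_ N (leqnn _)) Nr] := small _ r0.
  exists (t N); exists N => // k /= Nk.
  rewrite -ball_normE/= distrC er -(@ltr_pXn2r _ 2)// ?nnegrE ?normr_ge0 ?ler0c ?(ltW r0)//.
  by rewrite (le_lt_trans (dist_t _ _ Nk))// -rmorphXn ltcR.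
exists (lim (t @ \oo)) => r r0.
have rC : 0 < r%:C%C :> R[i] by rewrite ltcR.
have [N Nr] := small _ r0.
have /cvgrPdist_lt /(_ _ rC) [N' _ N'r] := tcvg.
exists (B (maxn N N')); split; first exact/N'r/leq_maxr.
move=> j jB; rewrite -(@ltr_pXn2r _ 2)// ?nnegrE ?normr_ge0 ?ler0c ?(ltW r0)//.
rewrite wE -rmorphXn ltcR (le_lt_trans _ (Nr _ (leq_maxl N N')))//.
pose C := B (maxn N N').
(* Adjoining [j] cannot push the sum above [m], so a coefficient outside [C] is small. *)
have jC : S (j |` C) = w j + S C by rewrite /S big_fsetU1.
rewrite -(lerD2r (S C)) -jC (le_trans (S_sup _))// ltW// addrC -ltrBlDr.
exact: BE.
Qed.

Close Scope fset_scope.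

Lemma real_le_small (z K : R[i]) : z \is Num.real -> 0 <= K ->
  (forall r : R, 0 < r -> z <= K * r%:C%C) -> z <= 0.
Proof.
move=> /complex_realP[a ->] K0 zK.
have [k kE] : exists k : R, K = k%:C%C by apply/complex_realP; rewrite ger0_real.
rewrite kE lecR in K0; rewrite lecR leNgt; apply/negP => a0.
(* The radius [a / (2 (k + 1))] gives a bound of at most [a / 2], contradicting [0 < a]. *)
have k1 : 0 < 2 * (k + 1) by lra.
have := zK _ (divr_gt0 a0 k1); rewrite kE -rmorphM lecR mulrA ler_pdivlMr//.
by nra.
Qed.

Lemma orthonormal_transport (J : choiceType) (e g : J -> H) x :
  orthonormal_family e -> orthonormal_family g ->
  exists y, [/\ forall j, '[y, g j] = '[x, e j],
    forall v, (forall j, '[g j, v] = 0) -> '[y, v] = 0 & `|y| <= `|x|].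
Proof.
move=> eP gP; have [y yP] := orthonormal_series x eP gP.
exists y; split=> [j|v gv|].
- apply/eqP; rewrite -subr_eq0 -normr_le0.
  (* One [r] pays for replacing [y] by [s], the other for the coefficient at [j] when [j] lies
     outside [A]. *)
  apply: (@real_le_small _ 2); rewrite ?normr_real// => r /yP[A [yA Ar]].
  set s := \sum_(j <- A) _ in yA.
  have -> : '[y, g j] - '[x, e j] = '[y - s, g j] + ('[s, g j] - '[x, e j]).
    by rewrite linearBl/= addrA subrK.
  rewrite (le_trans (ler_normD _ _))// mulr2n mulrDl !mul1r lerD//.
    rewrite (le_trans (CauchySchwarz_inner _ _))// (_ : `|g j| = 1) ?mulr1 ?ltW//.
    by apply/eqP; rewrite -(@eqrXn2 _ 2)// expr1n norm_inner gP eqxx.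
  rewrite (inner_orthonormal_sum gP (fun i => '[x, e i])); case: ifPn => [_|/Ar/ltW].
    by rewrite subrr normr0 ltW// (le_lt_trans _ yA).
  by rewrite sub0r normrN.
- apply/eqP; rewrite -normr_le0.
  apply: (@real_le_small _ `|v|); rewrite ?normr_real// => r /yP[A [yA _]].
  set s := \sum_(j <- A) _ in yA.
  have -> : '[y, v] = '[y - s, v].
    rewrite linearBl/= [X in _ - X]inner_suml big1 ?subr0// => i _.
    by rewrite linearZl/= gv mulr0.
  by rewrite (le_trans (CauchySchwarz_inner _ _))// mulrC ler_wpM2l// ltW.
- rewrite -subr_le0; apply: (@real_le_small _ 1); rewrite ?rpredB ?normr_real//.
  move=> r /yP[A [yA _]]; set s := \sum_(j <- A) _ in yA.
  rewrite mul1r lerBlDr -(subrK s y) (le_trans (ler_normD _ _))// lerD//; first exact: ltW.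
  rewrite -(@ler_pXn2r _ 2)// ?nnegrE//.
  by rewrite (norm_orthonormal_sum gP (fun i => '[x, e i])) Bessel.
Qed.

(** This is the partial isometry sending [e j] to [g j]. Its values are chosen pointwise; linearity
    follows because the two conditions determine each value. *)
Lemma bop_of_orthonormal (J : choiceType) (e g : J -> H) :
  orthonormal_family e -> orthonormal_family g ->
  exists T : bounded_operator H, (forall x j, '[T x, g j] = '[x, e j]) /\
    (forall x v, (forall j, '[g j, v] = 0) -> '[T x, v] = 0).
Proof.
move=> eP gP; have /choice[T TP] := fun x => orthonormal_transport x eP gP.
have Tg x j : '[T x, g j] = '[x, e j] by case: (TP x).
have Tv x v : (forall j, '[g j, v] = 0) -> '[T x, v] = 0 by case: (TP x) => _ Tv _; exact: Tv.
have Tbd : T \in @bounded_op R H.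
  apply/asboolP; split; last by exists 1 => x; rewrite mul1r; case: (TP x).
  move=> k x y; apply/eqP; rewrite -subr_eq0; apply/eqP/inner_eq0.
  (* The defect [d] is orthogonal to every [g j], so by [Tv] it is orthogonal to each of its own
     terms, hence to itself. *)
  set d := _ - _; have gd j : '[g j, d] = 0.
    rewrite innerC /d linearBl linearDl linearZl/= !Tg linearDl linearZl/= subrr.
    exact: rmorph0.
  by rewrite {1}/d linearBl linearDl linearZl/= !Tv// mulr0 addr0 subrr.
by exists (BoundedOperator Tbd).
Qed.

Lemma total_ext (J : Type) (e : J -> H) x y : total_family e ->
  (forall j, '[x, e j] = '[y, e j]) -> x = y.
Proof.
move=> et xy; apply/eqP; rewrite -subr_eq0; apply/eqP/et => j.
by rewrite linearBl/= xy subrr.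
Qed.

Lemma bop_of_orthonormal_basis (J : choiceType) (e g : J -> H)
    (T : bounded_operator H) : orthonormal_family e -> orthonormal_family g ->
  (forall x j, '[T x, g j] = '[x, e j]) ->
  (forall x v, (forall j, '[g j, v] = 0) -> '[T x, v] = 0) ->
  forall j, T (e j) = g j.
Proof.
move=> eP gP Tg Tv j; apply/eqP; rewrite -subr_eq0; apply/eqP/inner_eq0.
set d := _ - _; have gd i : '[g i, d] = 0.
  by rewrite innerC /d linearBl/= Tg eP gP subrr; exact: rmorph0.
by rewrite {1}/d linearBl/= Tv// gd subrr.
Qed.

(** The isometries send [e j] to [e (a j)] and to [e (b j)]. Their ranges are complementary because
    the images of [a] and [b] partition [J]. *)
Lemma cuntz_pair_of_total (J : choiceType) (e : J -> H) (a b : J -> J) :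
  orthonormal_family e -> total_family e ->
  injective a -> injective b -> (forall i j, a i != b j) ->
  (forall j, (exists i, j = a i) \/ exists i, j = b i) ->
  exists s1 s2 : bounded_operator H, [/\ star s1 * s1 = 1, star s2 * s2 = 1,
    star s1 * s2 = 0 & s1 * star s1 + s2 * star s2 = 1].
Proof.
move=> eP et ainj binj ab abJ.
have aP : orthonormal_family (e \o a) by move=> i j; rewrite /= eP (inj_eq ainj).
have bP : orthonormal_family (e \o b) by move=> i j; rewrite /= eP (inj_eq binj).
have [s1 [s1g s1v]] := bop_of_orthonormal eP aP.
have [s2 [s2g s2v]] := bop_of_orthonormal eP bP.
have s1e := bop_of_orthonormal_basis eP aP s1g s1v.
have s2e := bop_of_orthonormal_basis eP bP s2g s2v.
have s1b x j : '[s1 x, e (b j)] = 0.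
  by apply: s1v => i; rewrite /= eP (negPf (ab _ _)).
have s2a x j : '[s2 x, e (a j)] = 0.
  by apply: s2v => i; rewrite /= eP eq_sym (negPf (ab _ _)).
exists s1, s2; split; apply: bopP => x; apply: (total_ext et) => j.
- by rewrite [LHS]adjointEr s1e s1g.
- by rewrite [LHS]adjointEr s2e s2g.
- by rewrite [LHS]adjointEr s1e s2a linear0l.
have -> : '[(s1 * star s1 + s2 * star s2) x, e j] =
    '[s1 (adjoint s1 x), e j] + '[s2 (adjoint s2 x), e j].
  by rewrite -linearDl.
have [[i ->]|[i ->]] := abJ j.
  by rewrite s2a addr0 s1g adjointEr s1e.
by rewrite s1b add0r s2g adjointEr s2e.
Qed.

(** * An orthonormal basis that splits into two copies of itself *)

Lemma exists_unit_orth (P : H -> Prop) :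
  (exists2 v, v != 0 & P v) -> (forall k v, P v -> P (k *: v)) ->
  exists2 v, '[v, v] = 1 & P v.
Proof.
move=> [v v0 Pv] PZ; exists (`|v|^-1 *: v); last exact: PZ.
by rewrite -norm_inner normrZ normfV normr_id mulVf ?normr_eq0// expr1n.
Qed.

Lemma orthonormal_nth (b : seq H) : (forall v, v \in b -> '[v, v] = 1) ->
  pairwise (fun v w => '[v, w] == 0) b ->
  orthonormal_family (fun i : 'I_(size b) => nth 0 b i).
Proof.
move=> b1 /(pairwiseP 0) bP i j; case: eqVneq => [->|]; first by apply/b1/mem_nth.
have lt (m n : 'I_(size b)) : (m < n)%N -> '[nth 0 b m, nth 0 b n] = 0.
  by move=> mn; apply/eqP/bP; rewrite ?inE.
by rewrite neq_ltn => /orP[/lt|/lt ji]; rewrite // innerC ji conjC0.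
Qed.

(** Grouping basis vectors into sequences makes the index set a product with [nat], so halving it
    needs only even and odd numbers instead of cardinal arithmetic. *)
Definition orthonormal_sequences (F : set (nat -> H)) :=
  forall f g, F f -> F g -> forall m n, '[f m, g n] = ((f == g) && (m == n))%:R.

Lemma maximal_orthonormal_sequences : exists F, orthonormal_sequences F /\
  forall w : nat -> H, orthonormal_family w ->
    ~ (forall f m n, F f -> '[f m, w n] = 0).
Proof.
have [|F [FP Fmax]] := @Zorn_bigcup (nat -> H) orthonormal_sequences.
  move=> C CP Ctot f g [X CX Xf] [Y CY Yg].
  by have [XY|YX] := Ctot _ _ CX CY; [apply: (CP Y) => //; exact: XY|
    apply: (CP X) => //; exact: YX].
(* Adjoining [w] is a proper extension: if [w] were in [F], it would be orthogonal to itself. *)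
exists F; split=> // w wP wF; apply: (Fmax (F `|` [set w])).
  split=> [f Ff|sub]; first by left.
  have := wF w 0%N 0%N (sub _ (or_intror erefl)).
  by rewrite wP eqxx => /eqP; rewrite oner_eq0.
have wF' f m n : F f -> '[w n, f m] = 0.
  by move=> Ff; rewrite innerC wF// conjC0.
have neq f : F f -> (f == w) = false.
  move=> Ff; apply/eqP => fw; have := wF f 0%N 0%N Ff.
  by rewrite fw wP eqxx => /eqP; rewrite oner_eq0.
move=> f g [Ff|->] [Fg|->] m n; first exact: FP.
- by rewrite wF// neq.
- by rewrite wF'// eq_sym neq.
- by rewrite wP eqxx.
Qed.

(* If the orthogonal complement of [F] were infinite dimensional, it would contain
   an orthonormal sequence. *)
Lemma finite_complement (F : set (nat -> H)) :
  (forall w : nat -> H, orthonormal_family w ->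
    ~ (forall f m n, F f -> '[f m, w n] = 0)) ->
  exists b : seq H, [/\ orthonormal_family (fun i : 'I_(size b) => nth 0 b i),
    forall f n v, F f -> v \in b -> '[f n, v] = 0 &
    forall v, (forall f n, F f -> '[f n, v] = 0) ->
      (forall w, w \in b -> '[w, v] = 0) -> v = 0].
Proof.
move=> Fmax; apply: contrapT => nb.
pose good (b : seq H) := [/\ forall v, v \in b -> '[v, v] = 1,
  pairwise (fun v w => '[v, w] == 0) b &
  forall f n v, F f -> v \in b -> '[f n, v] = 0].
pose next (b : seq H) v := [/\ '[v, v] = 1, forall f n, F f -> '[f n, v] = 0 &
  forall w, w \in b -> '[w, v] = 0].
have /choice[nxt nxtP] : forall b : seq H, exists v, good b -> next b v.
  (* The default 0 is never reached below, since every [S n] is good. For a good [b], the absence of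
     a next vector would make [b] the list denied by [nb]. *)
  move=> b; have [gb|] := pselect (good b); last by exists 0.
  have [||v v1 [vF vb]] := @exists_unit_orth (fun v =>
    (forall f n, F f -> '[f n, v] = 0) /\ (forall w, w \in b -> '[w, v] = 0)).
  - apply: contrapT => nv; apply: nb; exists b.
    case: gb => b1 bp bF; split=> [|//|v vF vb]; first exact: orthonormal_nth.
    by apply: contrapT => /eqP v0; apply: nv; exists v.
  - move=> k v [vF vb]; split=> [f n Ff|w wb]; rewrite linearZr/=.
      by rewrite vF ?mulr0.
    by rewrite vb ?mulr0.
  by exists v.
pose S := fix S n := if n is n'.+1 then nxt (S n') :: S n' else [::].
have SP n : good (S n).
  elim: n => [|n gS] //=; have [v1 vF vb] := nxtP _ gS; case: (gS) => S1 Sp SF.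
  split=> [v||f k v Ff]; rewrite ?pairwise_cons ?inE.
  - by case/predU1P => [->|/S1].
  - rewrite Sp andbT; apply/allP => w wS /=.
    by rewrite innerC vb ?conjC0.
  - by case/predU1P => [->|/SF->//]; exact: vF.
have S_mem m n : (m < n)%N -> nxt (S m) \in S n.
  elim: n => // n IH; rewrite ltnS leq_eqVlt inE => /predU1P[->|/IH->].
    by rewrite eqxx.
  by rewrite orbT.
apply: (Fmax (fun n => nxt (S n))); last first.
  by move=> f m n Ff; have [_ -> ] := nxtP _ (SP n).
move=> m n; case: eqVneq => [->|]; first by have [] := nxtP _ (SP n).
have lt i j : (i < j)%N -> '[nxt (S i), nxt (S j)] = 0.
  by move=> ij; have [_ _ ->] := nxtP _ (SP j); rewrite ?S_mem.
by rewrite neq_ltn => /orP[/lt->//|/lt nm]; rewrite innerC nm conjC0.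
Qed.

Lemma exists_cuntz_pair : ~ finite_dimensional (K := R[i]) H ->
  exists s1 s2 : bounded_operator H, [/\ star s1 * s1 = 1, star s2 * s2 = 1,
    star s1 * s2 = 0 & s1 * star s1 + s2 * star s2 = 1].
Proof.
move=> infH; have [F [FP Fmax]] := maximal_orthonormal_sequences.
have [b [bP bF btot]] := finite_complement Fmax.
(* If [F] were empty, the finite list [b] would be total and hence span [H]. *)
have [f0 Ff0] : exists f0, F f0.
  apply: contrapT => F0; apply: infH; exists (size b), (fun i => nth 0 b i) => v.
  exists (fun i => '[v, nth 0 b i]); apply/eqP; rewrite -subr_eq0; apply/eqP.
  apply: btot => [f n Ff|w /(nthP 0)[k kb <-]]; first by exfalso; apply: F0; exists f.
  rewrite innerC linearBl/= inner_suml (bigD1 (Ordinal kb))//= linearZl/=.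
  rewrite (bP (Ordinal kb) (Ordinal kb)) eqxx mulr1 big1 ?addr0 ?subrr ?conjC0//.
  by move=> i ik; rewrite linearZl/= (bP i (Ordinal kb)) (negPf ik) mulr0.
(* Prepending [b] to the sequence [f0] gives an orthonormal basis indexed by
   [F * nat], which splits into its even and odd parts. *)
pose k := size b; pose J := (F * nat)%type.
pose f1 : F := SigSub (mem_set Ff0).
pose fv (f : F) : nat -> H := sval f.
pose e (j : J) : H := if j.1 == f1 then
  if (j.2 < k)%N then nth 0 b j.2 else fv f1 (j.2 - k)%N else fv j.1 j.2.
have eP : orthonormal_family e.
  have FE (f g : F) m n : '[fv f m, fv g n] = ((f == g) && (m == n))%:R.
    by rewrite FP//; exact/set_mem/valP.
  have bE m n : (m < k)%N -> (n < k)%N -> '[nth 0 b m, nth 0 b n] = (m == n)%:R.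
    by move=> mk nk; rewrite (bP (Ordinal mk) (Ordinal nk)).
  have Fb (f : F) m n : (n < k)%N -> '[fv f m, nth 0 b n] = 0.
    by move=> nk; apply: bF; [exact/set_mem/valP|exact: mem_nth].
  have bF' (f : F) m n : (n < k)%N -> '[nth 0 b n, fv f m] = 0.
    by move=> nk; rewrite innerC Fb// conjC0.
  move=> [f m] [g n]; rewrite /e xpair_eqE /= -[f0]/(fv f1).
  have [ff1|ff1] := eqVneq f f1; have [gf1|gf1] := eqVneq g f1.
  - rewrite ff1 gf1 eqxx andTb; case: ltnP => mk; case: ltnP => nk.
    + by rewrite bE.
    + by rewrite bF'// (ltn_eqF (leq_trans mk nk)).
    + by rewrite Fb// gtn_eqF// (leq_trans nk mk).
    + by rewrite FE eqxx andTb -(eqn_add2r k) !subnK.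
  - rewrite ff1 (eq_sym f1) (negPf gf1); case: ltnP => mk; first by rewrite bF'.
    by rewrite FE (eq_sym f1) (negPf gf1).
  - rewrite gf1 (negPf ff1); case: ltnP => nk; first by rewrite Fb.
    by rewrite FE (negPf ff1).
  - by rewrite FE.
have et : total_family e.
  move=> v ve; apply: btot => [f n Ff|w /(nthP 0)[n nk <-]]; last first.
    by have := ve (f1, n); rewrite /e /= eqxx nk innerC => /eqP;
      rewrite conjC_eq0 => /eqP.
  have [/(congr1 val)/= ff0|ff1] := eqVneq (SigSub (mem_set Ff) : F) f1.
    (* The [k] prepended vectors shift entry [n] of [f0] to position [n + k]. *)
    have := ve (f1, n + k)%N; rewrite /e /= eqxx ltnNge leq_addl/= addnK innerC.
    by rewrite ff0 => /eqP; rewrite conjC_eq0 => /eqP.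
  have := ve (SigSub (mem_set Ff), n); rewrite /e /= (negPf ff1) innerC => /eqP.
  by rewrite conjC_eq0 => /eqP.
apply: (@cuntz_pair_of_total _ e (fun j => (j.1, j.2.*2)) (fun j => (j.1, j.2.*2.+1))
  eP et).
- by move=> [f m] [g n] [-> /double_inj->].
- by move=> [f m] [g n] [-> /double_inj->].
- move=> [f m] [g n]; apply/eqP => -[_ /(congr1 odd)].
  by rewrite /= !odd_double.
- move=> [f n]; rewrite -(odd_double_half n); case: (odd n).
    by right; exists (f, n./2).
  by left; exists (f, n./2).
Qed.

End OrthonormalFamilies.

Theorem mainTheorem6 (R : realType) (A : cstarAlgType R)
    (hA : exists (H : hilbertType R)
                 (pi : {starhom bounded_operator H -> A}),
            ~ finite_dimensional (K := R[i]) H)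
    (M : awstarAlgType R) (phi : {starhom A -> M})
    (hphi : is_AWstar_discretization phi) :
  forall x : M, x = 0.
Proof.
have [H [pi infH]] := hA.
have [s1 [s2 [s11 s22 s12 s1s2]]] := exists_cuntz_pair infH.
exact: (cuntz_discretization_trivial pi s11 s22 s12 s1s2 hphi).
Qed.
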